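(* Let $X=\mathbb{R}^m$, $m\in\mathbb{N}$, with the Euclidean norm $\|\cdot\|$, and let $A:X\to 2^X$ be a maximally monotone operator whose zero set is nonempty. Consider the Algorithm described in the context with $\epsilon_n=0$ for all $n\in\mathbb{N}\cup\{0\}$, any $\sigma\in(0,\infty)$ (including $\sigma\ge1$), any $\theta\in\mathbb{R}$, arbitrary positive numbers $c_n$, arbitrary positive definite and symmetric linear operators $M_n:X\to X$, and arbitrary $\sigma_n\in[0,\sigma)$, $n\in\mathbb{N}\cup\{0\}$. Then there exist sequences which satisfy the Algorithm in the exact and inexact cases. More precisely, given $n\in\mathbb{N}\cup\{0\}$ (and $x_n$), at least one of the following possibilities holds: (i) $x_n$ is a zero of $A$ (i.e. $0\in Ax_n$). In this case the triplet $(y_n,\xi_n,\eta_n):=(x_n,0,0)$ satisfies the system (S) of the Algorithm. (ii) $\sigma_n=0$. In this case there exists a unique triplet $(y_n,\xi_n,\eta_n)\in X^3$ satisfying (S), namely $y_n=(I+c_nM_nA)^{-1}(x_n)$, $\xi_n=-(c_nM_n)^{-1}(y_n-x_n)$, $\eta_n=0$. (iii) $0\notin Ax_n$ and $\sigma_n>0$. In this case there exists $r_n>0$ such that for each $\eta_n\in X$ satisfying $\|\eta_n\|<r_n$ there exists a unique $(y_n,\xi_n)\in X^2$ such that (S) holds. Moreover, $$y_n=(I+c_nM_nA)^{-1}(x_n+\eta_n),\qquad \xi_n=(c_nM_n)^{-1}\eta_n-(c_nM_n)^{-1}(y_n-x_n).$$ Furthermore, suppose that for some $n\in\mathbb{N}\cup\{0\}$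 the Algorithm generates $x_n$ and that $\sigma_n\in[0,1)$. If $x_n=y_n$ (namely, the Algorithm terminates), then $x_n$ is a zero of $A$, and if $x_n\ne y_n$ (namely, the Algorithm continues), then $\xi_n\ne0$ (and hence $x_{n+1}$ is well defined).
   Context: $A:X\to 2^X$ is monotone if $\langle x_1^*-x_2^*,x_1-x_2\rangle\ge 0$ whenever $x_1^*\in Ax_1$, $x_2^*\in Ax_2$, and maximally monotone if its graph is not properly contained in the graph of another monotone operator. For $\epsilon\ge0$ the $\epsilon$-enlargement of $A$ is $A^{\epsilon}(x)=\{y\in X:\langle y'-y,x'-x\rangle\ge-\epsilon\ \ \forall x'\in X,\forall y'\in A(x')\}$. For a positive definite (symmetric) linear $M:X\to X$, $\|w\|_M=\sqrt{\langle Mw,w\rangle}$. $I$ is the identity and $(I+c_nM_nA)^{-1}(w)=\{x:w\in x+c_nM_n(Ax)\}$, which is a singleton under the present assumptions and is identified with its element. Algorithm (extended parameter range). Initialization: choose $x_0\in X$, $\sigma\in(0,\infty)$, $\theta\in\mathbb{R}$. Iterative step: given $n\in\mathbb{N}\cup\{0\}$ and $x_n\in X$, choose a positive definite symmetric linear operator $M_n:X\to X$, $c_n>0$ and $\sigma_n\in[0,\sigma)$. With $\epsilon_n\ge0$, find $(y_n,\xi_n,\eta_n)\in X^3$ satisfying $$\text{(S)}\quad \xi_n\in A^{\epsilon_n}(y_n),\quad \eta_n=c_nM_n\xi_n+y_n-x_n,\quad \|\eta_n\|^2_{M_n^{-1}}+2c_n\epsilon_n\le\sigma_n^2\left(\|c_nM_n\xi_n\|^2_{M_n^{-1}}+\|y_n-x_n\|^2_{M_n^{-1}}\right).$$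 If $y_n=x_n$, then stop. Otherwise choose $\tau_n\in[1-\theta,1+\theta]$ (interpreted as $\{t:1+\theta\le t\le1-\theta\}$ if $\theta<0$) and define $$a_n:=\frac{\langle\xi_n,x_n-y_n\rangle-\epsilon_n}{\|M_n\xi_n\|^2_{M_n^{-1}}},\qquad x_{n+1}:=x_n-\tau_na_nM_n\xi_n.$$ In the claim, $\epsilon_n=0$ for all $n$. ''Exact'' refers to $\eta_n=0$ and ''inexact'' to $\eta_n\ne 0$. *)

(* Defs.v *)
From HB Require Import structures.
From mathcomp Require Import all_boot all_order all_algebra.
From mathcomp Require Import boolp classical_sets reals.

Set Implicit Arguments.
Unset Strict Implicit.
Unset Printing Implicit Defensive.

Import Order.TTheory GRing.Theory Num.Theory.
Local Open Scope classical_set_scope.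
Local Open Scope ring_scope.

(* The space X is 'cV[R]_m. The norm that mathcomp-analysis puts on matrices is
   the sup norm, so the Euclidean structure is defined here. *)

Definition inner (R : realType) (m : nat) (u v : 'cV[R]_m) : R :=
  \sum_(i < m) u i 0 * v i 0.

Definition enorm (R : realType) (m : nat) (u : 'cV[R]_m) : R :=
  Num.sqrt (inner u u).

Definition wnorm (R : realType) (m : nat) (M : 'M[R]_m) (w : 'cV[R]_m) : R :=
  Num.sqrt (inner (M *m w) w).

Definition sym_posdef (R : realType) (m : nat) (M : 'M[R]_m) : Prop :=
  M^T = M /\ forall w : 'cV[R]_m, w != 0 -> 0 < inner (M *m w) w.

Definition graph (X : Type) (A : X -> set X) : set (X * X) :=
  [set p | A p.1 p.2].

Definition monotone_op (R : realType) (m : nat)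
    (A : 'cV[R]_m -> set 'cV[R]_m) : Prop :=
  forall x1 x2 x1' x2' : 'cV[R]_m,
    A x1 x1' -> A x2 x2' -> 0 <= inner (x1' - x2') (x1 - x2).

Definition maximally_monotone (R : realType) (m : nat)
    (A : 'cV[R]_m -> set 'cV[R]_m) : Prop :=
  monotone_op A /\
  forall B : 'cV[R]_m -> set 'cV[R]_m,
    monotone_op B -> ~ (graph A `<` graph B).

Definition zeros (R : realType) (m : nat) (A : 'cV[R]_m -> set 'cV[R]_m) :
    set 'cV[R]_m :=
  [set x | A x 0].

Definition enlargement (R : realType) (m : nat)
    (A : 'cV[R]_m -> set 'cV[R]_m) (eps : R) (x : 'cV[R]_m) : set 'cV[R]_m :=
  [set y | forall x' y' : 'cV[R]_m,
             A x' y' -> - eps <= inner (y' - y) (x' - x)].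

(* (I + c M A)^{-1} as a set-valued operator. *)
Definition resolvent (R : realType) (m : nat) (A : 'cV[R]_m -> set 'cV[R]_m)
    (c : R) (M : 'M[R]_m) (w : 'cV[R]_m) : set 'cV[R]_m :=
  [set x | exists2 u, A x u & w = x + c *: (M *m u)].

Record params (R : realType) (m : nat) := Params {
  cpar : nat -> R;
  Mpar : nat -> 'M[R]_m;
  spar : nat -> R; (* sigma_n *)
  epar : nat -> R; (* epsilon_n *)
  tpar : nat -> R  (* tau_n *)
}.

Definition relax_range (R : realType) (theta t : R) : Prop :=
  if 0 <= theta then 1 - theta <= t <= 1 + theta
  else 1 + theta <= t <= 1 - theta.

Definition admissible (R : realType) (m : nat) (sigma theta : R)
    (p : params R m) : Prop :=
  forall n : nat,
    [/\ 0 < cpar p n, sym_posdef (Mpar p n), 0 <= spar p n < sigma,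
        0 <= epar p n & relax_range theta (tpar p n)].

Definition sysS (R : realType) (m : nat) (A : 'cV[R]_m -> set 'cV[R]_m)
    (p : params R m) (n : nat) (x y xi eta : 'cV[R]_m) : Prop :=
  let c := cpar p n in
  let M := Mpar p n in
  [/\ enlargement A (epar p n) y xi,
      eta = c *: (M *m xi) + y - x
    & wnorm (invmx M) eta ^+ 2 + 2 * c * epar p n
        <= spar p n ^+ 2 * (wnorm (invmx M) (c *: (M *m xi)) ^+ 2
                            + wnorm (invmx M) (y - x) ^+ 2)].

Definition step_den (R : realType) (m : nat) (p : params R m) (n : nat)
    (xi : 'cV[R]_m) : R :=
  wnorm (invmx (Mpar p n)) (Mpar p n *m xi) ^+ 2.

Definition step_len (R : realType) (m : nat) (p : params R m) (n : nat)
    (x y xi : 'cV[R]_m) : R :=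
  (inner xi (x - y) - epar p n) / step_den p n xi.

Record iterates (R : realType) (m : nat) := Iterates {
  xseq : nat -> 'cV[R]_m;
  yseq : nat -> 'cV[R]_m;
  xiseq : nat -> 'cV[R]_m;
  etaseq : nat -> 'cV[R]_m
}.

Definition sysS_at (R : realType) (m : nat) (A : 'cV[R]_m -> set 'cV[R]_m)
    (p : params R m) (s : iterates R m) (n : nat) : Prop :=
  sysS A p n (xseq s n) (yseq s n) (xiseq s n) (etaseq s n).

(* Since division is total, that a_n is well defined has to be required
   explicitly, through its denominator. *)
Definition update_at (R : realType) (m : nat) (p : params R m)
    (s : iterates R m) (n : nat) : Prop :=
  step_den p n (xiseq s n) != 0 /\
  xseq s n.+1 = xseq s n
    - (tpar p n * step_len p n (xseq s n) (yseq s n) (xiseq s n))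
      *: (Mpar p n *m xiseq s n).

(* The algorithm started at x0 reaches iteration n: all earlier iterations were
   carried out without stopping. *)
Definition generates (R : realType) (m : nat) (A : 'cV[R]_m -> set 'cV[R]_m)
    (p : params R m) (x0 : 'cV[R]_m) (s : iterates R m) (n : nat) : Prop :=
  xseq s 0%N = x0 /\
  forall k : nat, (k < n)%N ->
    [/\ sysS_at A p s k, yseq s k <> xseq s k & update_at p s k].

(* A complete run, either infinite or stopped at the first n with y_n = x_n; in
   the latter case the entries beyond n are unconstrained junk. *)
Definition algorithm_run (R : realType) (m : nat)
    (A : 'cV[R]_m -> set 'cV[R]_m) (p : params R m) (x0 : 'cV[R]_m)
    (s : iterates R m) : Prop :=
  xseq s 0%N = x0 /\
  forall n : nat, generates A p x0 s n ->
    sysS_at A p s n /\ (yseq s n <> xseq s n -> update_at p s n).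

(* Main.v *)
(* The system (S) with eps_n = 0 says that y_n is a resolvent value at
   x_n + eta_n and that the error eta_n passes the relative test. So everything
   rests on Minty's theorem that the resolvent is defined everywhere: minimise
   F(x, v) + (<N x, x> + <N^-1 v, v>)/2, where F is the Fitzpatrick function of
   A and N = (c_n M_n)^-1. The minimum exists by strong convexity, and since
   F(x, v) >= <x, v>, with equality on the graph, its optimality condition says
   that (-N^-1 v, -N x) is monotonically related to the graph, hence in it, and
   that v = - N x. The resolvent is nonexpansive for the norm given by N; if x_n
   is not a zero then y_n differs from x_n at eta_n = 0, so the right-hand side
   of the error test stays bounded away from 0 while its left-hand side tends
   to 0 with eta_n. The same estimate keeps xi_n nonzero for small eta_n, which
   lets the inexact algorithm continue even when sigma_n >= 1. *)
Require Import Defs.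
From mathcomp Require Import all_boot all_order all_algebra.
From mathcomp Require Import boolp classical_sets reals.
From mathcomp Require Import ring lra.

Import Order.TTheory GRing.Theory Num.Theory.
Local Open Scope classical_set_scope.
Local Open Scope ring_scope.

(** * Inner product and positive definite forms *)

Section InnerProduct.
#[local] Set Implicit Arguments.
#[local] Unset Strict Implicit.
Context {R : realType} {m : nat}.
Implicit Types (u v w : 'cV[R]_m) (M N : 'M[R]_m) (a : R).

Lemma inner_mulmx u v : inner u v = (u^T *m v) 0 0.
Proof. by rewrite mxE; apply: eq_bigr => i _; rewrite mxE. Qed.

Lemma innerC u v : inner u v = inner v u.
Proof. by apply: eq_bigr => i _; rewrite mulrC. Qed.

Lemma innerDl u v w : inner (u + v) w = inner u w + inner v w.
Proof. by rewrite !inner_mulmx linearD mulmxDl mxE. Qed.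

Lemma innerDr u v w : inner w (u + v) = inner w u + inner w v.
Proof. by rewrite innerC innerDl !(innerC w). Qed.

Lemma innerZl a u v : inner (a *: u) v = a * inner u v.
Proof. by rewrite !inner_mulmx linearZ -scalemxAl mxE. Qed.

Lemma innerZr a u v : inner u (a *: v) = a * inner u v.
Proof. by rewrite innerC innerZl innerC. Qed.

Lemma innerNl u v : inner (- u) v = - inner u v.
Proof. by rewrite -scaleN1r innerZl mulN1r. Qed.

Lemma innerNr u v : inner u (- v) = - inner u v.
Proof. by rewrite innerC innerNl innerC. Qed.

Lemma inner0l u : inner 0 u = 0.
Proof. by rewrite inner_mulmx trmx0 mul0mx mxE. Qed.

Lemma mulmxZr a M u : M *m (a *: u) = a *: (M *m u).
Proof. by rewrite scalemxAr. Qed.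

Definition innerE := (innerDl, innerDr, innerNl, innerNr, innerZl, innerZr,
  @mulmxDr R, @mulmxN R, mulmxZr).

Lemma inner_sym M u v : M^T = M -> inner (M *m u) v = inner (M *m v) u.
Proof.
by move=> sM; rewrite [RHS]innerC !inner_mulmx trmx_mul sM mulmxA.
Qed.

Lemma inner_delta u i : inner (delta_mx i 0) u = u i 0.
Proof.
rewrite /inner (bigD1 i)//= big1 ?addr0 => [|j jNi]; rewrite !mxE.
  by rewrite !eqxx mul1r.
by rewrite (negPf jNi) mul0r.
Qed.

Lemma inner_self_ge0 u : 0 <= inner u u.
Proof. by apply: sumr_ge0 => i _; rewrite -expr2 sqr_ge0. Qed.

Lemma sqr_coord_le u i : u i 0 ^+ 2 <= inner u u.
Proof.
rewrite /inner (bigD1 i)//= -expr2 lerDl; apply: sumr_ge0 => j _.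
by rewrite -expr2 sqr_ge0.
Qed.

Lemma quadratic_form_bounded M :
  exists2 C, 0 < C & forall u, inner (M *m u) u <= C * inner u u.
Proof.
exists (1 + \sum_i \sum_j `|M i j|) => [|u].
  by rewrite ltr_pwDl// sumr_ge0// => i _; rewrite sumr_ge0.
rewrite mulrDl mul1r -[leLHS]add0r lerD ?inner_self_ge0// mulr_suml.
apply: ler_sum => i _; rewrite mxE !mulr_suml; apply: ler_sum => j _.
rewrite -mulrA; apply: le_trans (ler_norm _) _; rewrite normrM.
rewrite ler_wpM2l// ler_norml.
have := sqr_coord_le u i; have := sqr_coord_le u j.
by have := sqr_ge0 (u i 0 + u j 0); have := sqr_ge0 (u i 0 - u j 0); nra.
Qed.

Lemma sym_posdef_unit M : sym_posdef M -> M \in unitmx.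
Proof.
move=> [sM pM]; rewrite unitmxE unitfE; apply/negP => /det0P[v v0 vM].
have /pM : v^T != 0 by rewrite trmx_eq0.
by rewrite -{1}sM -trmx_mul vM trmx0 inner0l ltxx.
Qed.

Lemma sym_posdef_inv M : sym_posdef M -> sym_posdef (invmx M).
Proof.
move=> spdM; have uM := sym_posdef_unit spdM; case: spdM => sM pM.
split=> [|w w0]; first by rewrite trmx_inv sM.
have /pM : invmx M *m w != 0.
  by apply: contra_neq w0 => w0; rewrite -(mulKVmx uM w) w0 mulmx0.
by rewrite mulKVmx// innerC.
Qed.

Lemma sym_posdef_scale a M : 0 < a -> sym_posdef M -> sym_posdef (a *: M).
Proof.
move=> a0 [sM pM]; split=> [|w w0]; first by rewrite linearZ /= sM.
by rewrite -scalemxAl innerZl mulr_gt0 ?pM.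
Qed.

Lemma sym_posdef_ge0 M u : sym_posdef M -> 0 <= inner (M *m u) u.
Proof.
move=> [_ pM]; have [->|/pM/ltW//] := eqVneq u 0.
by rewrite mulmx0 inner0l.
Qed.

Lemma sym_posdef_le0 M u : sym_posdef M -> inner (M *m u) u <= 0 -> u = 0.
Proof.
by move=> [_ pM] Mu; apply: contraTeq Mu => /pM; rewrite ltNge.
Qed.

Lemma wnorm_sqr M u : sym_posdef M -> wnorm M u ^+ 2 = inner (M *m u) u.
Proof. by move=> pM; rewrite sqr_sqrtr ?sym_posdef_ge0. Qed.

Lemma Cauchy_Schwarz_form M u v : sym_posdef M ->
  inner (M *m u) v ^+ 2 <= inner (M *m u) u * inner (M *m v) v.
Proof.
move=> pM; have [->|v0] := eqVneq v 0.
  by rewrite mulmx0 inner0l innerC inner0l expr0n mulr0.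
have Mv : 0 < inner (M *m v) v by apply: pM.2.
(* The form is nonnegative at [<Mv, v> u - <Mu, v> v]; its value there is [<Mv, v>] times the gap in
   the inequality. *)
have := sym_posdef_ge0
  (inner (M *m v) v *: u - inner (M *m u) v *: v) pM.
have -> : forall p q, inner (M *m (p *: u - q *: v)) (p *: u - q *: v)
    = p ^+ 2 * inner (M *m u) u - p * q * inner (M *m u) v *+ 2
      + q ^+ 2 * inner (M *m v) v.
  by move=> p q; rewrite !innerE (inner_sym v u pM.1); ring.
set p := inner (M *m v) v in Mv *; set q := inner (M *m u) v.
set r := inner (M *m u) u.
rewrite (_ : _ + _ = p * (r * p - q ^+ 2)); last by ring.
by rewrite pmulr_rge0// subr_ge0.
Qed.

(** Cauchy-Schwarz at [M^-1 e_i], since [u i 0 = <M (M^-1 e_i), u>]. With this bound, limits can be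
    taken one coordinate at a time. *)
Lemma coord_le_form M i : sym_posdef M -> exists2 C, 0 < C &
  forall u, u i 0 ^+ 2 <= C * inner (M *m u) u.
Proof.
move=> pM; have uM := sym_posdef_unit pM; pose e : 'cV[R]_m := delta_mx i 0.
exists (1 + inner (invmx M *m e) e) => [|u].
  by rewrite ltr_pwDl// sym_posdef_ge0//; apply: sym_posdef_inv.
rewrite mulrDl mul1r -[leLHS]add0r lerD ?sym_posdef_ge0//.
have := Cauchy_Schwarz_form (invmx M *m e) u pM.
by rewrite mulKVmx// inner_delta [inner e _]innerC.
Qed.

End InnerProduct.

Lemma inner_col_mx {R : realType} {m n : nat} (u u' : 'cV[R]_m)
    (v v' : 'cV[R]_n) :
  inner (col_mx u v) (col_mx u' v') = inner u u' + inner v v'.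
Proof. by rewrite !inner_mulmx tr_col_mx mul_row_col mxE. Qed.

Lemma sym_posdef_block {R : realType} {m n : nat} {M : 'M[R]_m} {N : 'M[R]_n} :
  sym_posdef M -> sym_posdef N -> sym_posdef (block_mx M 0 0 N).
Proof.
move=> pM pN; split=> [|w]; first by rewrite tr_block_mx pM.1 pN.1 !trmx0.
rewrite -[w]vsubmxK; set u := usubmx w; set v := dsubmx w.
rewrite mul_block_col !mul0mx addr0 add0r inner_col_mx => w0.
rewrite lt_neqAle addr_ge0 ?sym_posdef_ge0// andbT.
apply: contraNneq w0 => /esym/eqP.
rewrite paddr_eq0 ?sym_posdef_ge0// => /andP[/eqP Mu /eqP Nv].
rewrite (sym_posdef_le0 pM (u := u)) ?Mu// (sym_posdef_le0 pN (u := v)) ?Nv//.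
by rewrite col_mx0.
Qed.

(** * Minimisation of strongly convex functions *)

(** Cantor's nested set principle with a rate. The sets need not be closed, so [x0], the supremum of
    the lower bounds of all [S e], is only close to each [S d], not in it. *)
Lemma nested_sets_point {R : realType} (S : R -> set R) (C : R) :
  (forall d, 0 < d -> S d !=set0) ->
  (forall d e, d <= e -> S d `<=` S e) ->
  (forall d x y, 0 < d -> S d x -> S d y -> x - y <= d * C) ->
  exists x0, forall d x, 0 < d -> S d x -> `|x - x0| <= d * C.
Proof.
move=> S0 Smono Sdiam.
pose L : set R := [set y | exists2 e, 0 < e & lbound (S e) y].
have lbS d x y : 0 < d -> S d x -> L y -> y <= x + d * C.
  move=> d0 Sdx [e e0 lby].
  (* A point of the smaller set lies in both [S d] and [S e]. *)
  have [|u Su] := S0 (Num.min d e); first by rewrite lt_min d0 e0.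
  have leu : y <= u by apply: lby; apply: Smono Su; rewrite ge_min lexx orbT.
  have Sdu : S d u by apply: Smono Su; rewrite ge_min lexx.
  by have := Sdiam _ _ _ d0 Sdu Sdx; lra.
have Lx d x : 0 < d -> S d x -> L (x - d * C).
  by move=> d0 Sdx; exists d => // y Sdy; have := Sdiam _ _ _ d0 Sdx Sdy; lra.
exists (sup L) => d x d0 Sdx.
have hsL : has_sup L.
  by split; [exists (x - d * C); apply: Lx | exists (x + d * C) => y; apply: lbS].
rewrite ler_distlC; apply/andP; split.
  by apply: ub_le_sup; [exact: hsL.2 | exact: Lx].
by apply: ge_sup; [exact: hsL.1 | move=> y; apply: lbS].
Qed.

Section StronglyConvexMinimum.
#[local] Set Implicit Arguments.
#[local] Unset Strict Implicit.
Context {R : realType} {k : nat} {I : Type}.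
Variables (D : set I) (b : I -> 'cV[R]_k) (g : I -> R) (P : 'M[R]_k).
Hypothesis pP : sym_posdef P.

(* The epigraph of [z |-> sup_(i in D) (<b i, z> + g i) + <P z, z> / 2];
   working with it avoids infinite values of the supremum. *)
Definition epi (z : 'cV[R]_k) (t : R) : Prop :=
  forall i, D i -> inner (b i) z + g i + inner (P *m z) z / 2 <= t.

(** Affine terms interpolate exactly, and a quadratic form lies below its chord by exactly
    [s (1 - s)] times its value at [z' - z]. *)
Lemma epi_convex z z' t t' s : 0 <= s <= 1 -> epi z t -> epi z' t' ->
  epi (z + s *: (z' - z))
      (t + s * (t' - t) - s * (1 - s) * inner (P *m (z' - z)) (z' - z) / 2).
Proof.
move=> /andP[s0 s1] Ez Ez' i Di.
have /(ler_wpM2l s0) := Ez' i Di.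
have : 0 <= 1 - s by lra.
move=> /ler_wpM2l /(_ _ _ (Ez i Di)).
rewrite !innerE (inner_sym z' z pP.1).
lra.
Qed.

Hypothesis epi_nonempty : exists z t, epi z t.
Hypothesis epi_ge0 : forall z t, epi z t -> 0 <= t.

Let mu := inf [set t | exists z, epi z t].

Let mu_le z t : epi z t -> mu <= t.
Proof.
move=> Ez; apply: ge_inf; last by exists z.
by exists 0 => u [z' /epi_ge0].
Qed.

Let mu_adherent e : 0 < e -> exists z t, epi z t /\ t <= mu + e.
Proof.
move=> e0; have [|t [z Ez] tlt] := @inf_adherent R [set t | exists z, epi z t] _ e0.
  split; last by exists 0 => u [z' /epi_ge0].
  by have [z [t Ez]] := epi_nonempty; exists t, z.
by exists z, t; split=> //; exact: ltW.
Qed.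

(** By strong convexity the midpoint has a height at most [mu + e] minus an eighth of the left-hand
    side, yet at least [mu]. *)
Let sublevel_diam e z z' t t' :
  epi z t -> epi z' t' -> t <= mu + e -> t' <= mu + e ->
  inner (P *m (z - z')) (z - z') <= 8 * e.
Proof.
move=> Ez Ez' te t'e.
have s01 : 0 <= (1 / 2 : R) <= 1 by lra.
by have /mu_le := epi_convex s01 Ez' Ez; lra.
Qed.

Let coord_limit i : exists x C, 0 <= C /\ forall d z t, 0 < d -> epi z t ->
  t <= mu + d ^+ 2 -> `|z i 0 - x| <= d * C.
Proof.
have [K K0 coordK] := coord_le_form i pP.
(* Squared differences are at most [8 K d^2], and [8 K <= C^2] spares a square root. *)
pose C := 1 + 8 * K.
(* Allowing height [d^2] above [mu] makes the diameter linear in [d]; the maximum keeps [S]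
   increasing for negative [d] as well. *)
pose S d : set R := [set x | exists z t,
  [/\ epi z t, t <= mu + Num.max 0 d ^+ 2 & x = z i 0]].
have [d d0|d e de|d x y d0|x0 Sx0] := @nested_sets_point R S C.
- have [|z [t [Ez tz]]] := @mu_adherent (d ^+ 2); first by rewrite exprn_gt0.
  by exists (z i 0), z, t; split; rewrite // (max_r (ltW d0)).
- move=> x [z [t [Ez tz ->]]]; exists z, t; split=> //.
  apply: le_trans tz _; rewrite lerD2l lerXn2r// ?nnegrE.
  + by rewrite le_max lexx.
  + by rewrite le_max lexx.
  + by rewrite ge_max !le_max lexx de orbT.
- move=> [z [t [Ez tz ->]]] [z' [t' [Ez' tz' ->]]].
  rewrite (max_r (ltW d0)) in tz tz'.
  have diam := sublevel_diam Ez Ez' tz tz'.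
  have := coordK (z - z'); rewrite !mxE => sqrz.
  have {}sqrz : (z i 0 - z' i 0) ^+ 2 <= (d * C) ^+ 2.
    apply: le_trans sqrz _; apply: le_trans (ler_wpM2l (ltW K0) diam) _.
    by rewrite exprMn /C; have := exprn_gt0 2 d0; nra.
  have dC : 0 <= d * C by rewrite mulr_ge0 ?(ltW d0)// /C; lra.
  by nra.
- exists x0, C; split; first by rewrite /C; lra.
  move=> d z t d0 Ez tz; apply: Sx0 => //.
  by exists z, t; split; rewrite // (max_r (ltW d0)).
Qed.

Lemma strongly_convex_minimum : exists z0 t0, epi z0 t0 /\
  forall z t, epi z t -> t0 + inner (P *m (z - z0)) (z - z0) / 2 <= t.
Proof.
have [f fP] := choice coord_limit; have {fP} [C fP] := choice fP.
pose z0 : 'cV[R]_k := \col_i f i.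
have E0 : epi z0 mu.
  (* [l] is the gradient at [z0] of the [i]-th quadratic, which lies above its tangent there.
     Near-minimisers [z] satisfy [<l, z - z0> >= - d K], so the value at [z0] exceeds [mu] by at
     most [d^2 + d K]. *)
  move=> i Di; pose l := b i + P *m z0.
  pose K := \sum_j `|l j 0| * C j.
  have K0 : 0 <= K by apply: sumr_ge0 => j _; rewrite mulr_ge0//; case: (fP j).
  apply/ler_addgt0Pr => e e0.
  pose d := Num.min 1 (e / (1 + K)).
  have d0 : 0 < d by rewrite lt_min ltr01 divr_gt0// ltr_pwDl.
  have [|z [t [Ez tz]]] := @mu_adherent (d ^+ 2); first by rewrite exprn_gt0.
  have lz : - (d * K) <= inner l (z - z0).
    rewrite lerNl; apply: le_trans (ler_norm _) _; rewrite normrN.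
    apply: le_trans (ler_norm_sum _ _ _) _; rewrite mulr_sumr ler_sum// => j _.
    rewrite normrM mulrCA ler_wpM2l// !mxE.
    by have [_] := fP j; apply; [exact: d0 | exact: Ez | exact: tz].
  have := Ez i Di; have := sym_posdef_ge0 (z - z0) pP.
  move: lz; rewrite /l !innerE (inner_sym z z0 pP.1).
  have d1 : d <= 1 by rewrite ge_min lexx.
  have : d * (1 + K) <= e.
    by rewrite -ler_pdivlMr ?ltr_pwDl// ge_min lexx orbT.
  have : d ^+ 2 <= d by rewrite expr2 ger_pMr.
  by lra.
exists z0, mu; split=> // z t Ez.
set Q := inner _ _; have Q0 : 0 <= Q by apply: sym_posdef_ge0.
(* Minimality on the segment from [z0] to [z], divided by [s]; letting [s] tend to 0 gives the full
   growth term. *)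
have le_s s : 0 < s -> s <= 1 -> mu + (1 - s) * Q / 2 <= t.
  move=> s0 s1; have s01 : 0 <= s <= 1 by rewrite ltW.
  have /mu_le := epi_convex s01 E0 Ez; rewrite -/Q => le_mu.
  by rewrite -(ler_pM2l s0); lra.
apply/ler_addgt0Pr => e e0.
pose s := Num.min 1 (e / (1 + Q)).
have s0 : 0 < s by rewrite lt_min ltr01 divr_gt0// ltr_pwDl.
have s1 : s <= 1 by rewrite ge_min lexx.
have : s * (1 + Q) <= e by rewrite -ler_pdivlMr ?ltr_pwDl// ge_min lexx orbT.
by have := le_s s s0 s1; nra.
Qed.

End StronglyConvexMinimum.

(** * Maximal monotonicity and Minty's theorem *)

Section MaximallyMonotone.
#[local] Set Implicit Arguments.
#[local] Unset Strict Implicit.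
Context {R : realType} {m : nat}.
Variable A : 'cV[R]_m -> set 'cV[R]_m.
Hypothesis maxA : maximally_monotone A.

(** A pair monotonically related to the whole graph can be adjoined to it without losing
    monotonicity, so maximality puts it in the graph. *)
Lemma maximally_monotoneP x u :
  A x u <-> forall a a', A a a' -> 0 <= inner (a' - u) (a - x).
Proof.
case: maxA => monA maxlA; split=> [Axu a a' Aa|rel]; first exact: monA.
apply: contrapT => nAxu.
pose B y : set 'cV[R]_m := [set v | A y v \/ y = x /\ v = u].
apply: (maxlA B) => [x1 x2 v1 v2 [A1|[-> ->]] [A2|[-> ->]]|].
- exact: monA.
- exact: rel.
- by rewrite -opprB -(opprB x2) innerNl innerNr opprK; apply: rel.
- by rewrite !subrr inner0l.
split=> [[y v] Ayv|BA]; first by left.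
by apply: nAxu; apply: (BA (x, u)); right.
Qed.

Lemma enlargement0P x u : enlargement A 0 x u <-> A x u.
Proof.
by rewrite maximally_monotoneP /enlargement /= oppr0; split.
Qed.

Hypothesis domA : exists x u, A x u.

(* Minty's theorem, for the inner product weighted by [N] and resolvents
   centred at [w]. *)
Lemma Minty_surjective (N : 'M[R]_m) (w : 'cV[R]_m) : sym_posdef N ->
  exists x, A x (N *m (w - x)).
Proof.
move=> pN; pose N' := invmx N.
have pN' : sym_posdef N' by apply: sym_posdef_inv.
have NN' v : N *m (N' *m v) = v by apply: mulKVmx; apply: sym_posdef_unit.
have N'N v : N' *m (N *m v) = v by apply: mulKmx; apply: sym_posdef_unit.
pose P := block_mx N 0 0 N'.
have PE x v : inner (P *m col_mx x v) (col_mx x v)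
    = inner (N *m x) x + inner (N' *m v) v.
  by rewrite mul_block_col !mul0mx addr0 add0r inner_col_mx.
(* Translation by [w] moves the centre to 0. The supremum over [D] of the affine functions given by
   [b] and [g] is the Fitzpatrick function of the translated operator. *)
pose D := [set q : 'cV[R]_m * 'cV[R]_m | A (q.1 + w) q.2].
pose b (q : 'cV[R]_m * 'cV[R]_m) := col_mx q.2 q.1.
pose g (q : 'cV[R]_m * 'cV[R]_m) := - inner q.1 q.2.
have AP x u : A (x + w) u <->
    forall a a', A (a + w) a' -> 0 <= inner (a' - u) (a - x).
  rewrite maximally_monotoneP; split=> rel a a' Aa.
    by have := rel _ _ Aa; rewrite opprD addrACA subrr addr0.
  have := rel (a - w) a'; rewrite subrK => /(_ Aa).
  by rewrite -addrA -opprD [w + x]addrC.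
(* On the graph, the term of [(x, v)] itself equals [<x, v>]; off the graph, a pair violating
   monotonicity with [(x, v)] gives a larger term. *)
have epi_ge x v t : epi D b g P (col_mx x v) t ->
    inner x v + (inner (N *m x) x + inner (N' *m v) v) / 2 <= t.
  move=> Exv; have [Axv|nAxv] := pselect (A (x + w) v).
    by have := Exv (x, v) Axv; rewrite /b /g PE /= inner_col_mx (innerC v x); lra.
  have /existsNP[a /existsNP[a' /not_implyP[Aa /negP]]] :
    ~ forall a a', A (a + w) a' -> 0 <= inner (a' - v) (a - x) by move/AP.
  rewrite -ltNge !innerE; have := Exv (a, a') Aa.
  by rewrite /b /g PE /= inner_col_mx (innerC a' a) (innerC v a) (innerC v x); lra.
have epi_graph x v : A (x + w) v ->
    epi D b g P (col_mx x v)
      (inner x v + (inner (N *m x) x + inner (N' *m v) v) / 2).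
  move=> Axv [a a'] /= Aa; rewrite /b /g PE /= inner_col_mx.
  have := (AP x v).1 Axv _ _ Aa; rewrite !innerE.
  by rewrite (innerC a' a) (innerC v a) (innerC v x); lra.
(* Half of this square is the lower bound in [epi_ge], so heights are nonnegative. *)
have squareE x v : inner (N' *m (N *m x + v)) (N *m x + v)
    = inner (N *m x) x + 2 * inner x v + inner (N' *m v) v.
  rewrite !innerE !N'N (innerC x (N *m x)) [inner (N' *m v) (N *m x)]innerC.
  by rewrite (inner_sym x (N' *m v) pN.1) NN' (innerC v x); ring.
have [||z0 [t0 [E0 min0]]] :=
    @strongly_convex_minimum R _ _ D b g P (sym_posdef_block pN pN').
- have [x [v Axv]] := domA; have := epi_graph (x - w) v; rewrite subrK.
  by move/(_ Axv) => Exv; eexists; eexists; exact: Exv.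
- move=> z t; rewrite -[z]vsubmxK => /epi_ge.
  have := sym_posdef_ge0 (N *m usubmx z + dsubmx z) pN'.
  by rewrite squareE; lra.
move: E0 min0; rewrite -[z0]vsubmxK.
set x0 := usubmx z0; set v0 := dsubmx z0 => /epi_ge E0 min0.
(* The growth estimate at a graph point: the quadratic terms in [a] and [a'] cancel, and [t0] is at
   least half the square at [(x0, v0)]. *)
have subgrad a a' : A (a + w) a' ->
    inner (N' *m (N *m x0 + v0)) (N *m x0 + v0)
      <= inner (a' - - (N *m x0)) (a - - (N' *m v0)).
  move=> /epi_graph /min0; rewrite opp_col_mx add_col_mx PE squareE !opprK.
  rewrite !innerE (innerC a' a) (inner_sym x0 a pN.1).
  rewrite (inner_sym x0 (N' *m v0) pN.1) NN' (innerC v0 x0).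
  by rewrite (innerC a' (N' *m v0)) (inner_sym a' v0 pN'.1); lra.
have A0 : A (- (N' *m v0) + w) (- (N *m x0)).
  apply/AP => a a' Aa; apply: le_trans (subgrad _ _ Aa).
  exact: sym_posdef_ge0.
(* Tested at this very pair, the right-hand side is 0, which forces [v0 = - N x0]. *)
have := subgrad _ _ A0; rewrite subrr inner0l => /(sym_posdef_le0 pN') Nx0v0.
have x0E : x0 = - (N' *m v0).
  apply/eqP; rewrite -addr_eq0 -[X in X + _]N'N -mulmxDr Nx0v0.
  by rewrite mulmx0.
by exists (x0 + w); rewrite {1}x0E opprD addrCA subrr addr0 mulmxN.
Qed.

End MaximallyMonotone.

(** * Solvability of the system (S) at one step *)

Section OneStep.
#[local] Set Implicit Arguments.
#[local] Unset Strict Implicit.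
Context {R : realType} {m : nat}.
Variable A : 'cV[R]_m -> set 'cV[R]_m.
Hypotheses (maxA : maximally_monotone A) (domA : exists x u, A x u).
Variables (p : params R m) (n : nat).
Local Notation c := (cpar p n).
Local Notation M := (Mpar p n).
Local Notation sigma := (spar p n).
Hypotheses (c_gt0 : 0 < c) (pM : sym_posdef M) (eps0 : epar p n = 0).

(** Its quadratic form is [c^-1] times that of [M^-1], so the relative error test is unchanged, and
    [y] is the resolvent value at [w] exactly when [A y (N (w - y))]. *)
Let N := invmx (c *: M).

Let pcM : sym_posdef (c *: M). Proof. exact: sym_posdef_scale. Qed.
Let pN : sym_posdef N. Proof. exact: sym_posdef_inv. Qed.
Let NcM (v : 'cV[R]_m) : N *m (c *: M *m v) = v.
Proof. by apply: mulKmx; apply: sym_posdef_unit. Qed.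
Let cMN (v : 'cV[R]_m) : c *: M *m (N *m v) = v.
Proof. by apply: mulKVmx; apply: sym_posdef_unit. Qed.

Lemma resolventP w y : resolvent A c M w y <-> A y (N *m (w - y)).
Proof.
split=> [[u Ayu ->]|AyN]; first by rewrite addrC addKr scalemxAl NcM.
by exists (N *m (w - y)); rewrite // scalemxAl cMN addrC subrK.
Qed.

(** With [dw = w - w'] and [dy = y - y'], monotonicity says [<N (dw - dy), dy> >= 0]; expand the
    square of [dw = (dw - dy) + dy]. *)
Lemma resolvent_nonexpansive w w' y y' :
  resolvent A c M w y -> resolvent A c M w' y' ->
  inner (N *m (y - y')) (y - y') <= inner (N *m (w - w')) (w - w').
Proof.
move=> /resolventP Ay /resolventP Ay'; have := maxA.1 _ _ _ _ Ay Ay'.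
rewrite -mulmxBr opprD addrACA -opprD mulmxBr.
have := sym_posdef_ge0 ((w - w') - (y - y')) pN.
move: (w - w') (y - y') => dw dy.
by rewrite !innerE (inner_sym dy dw pN.1); lra.
Qed.

Lemma resolvent_inj w y y' :
  resolvent A c M w y -> resolvent A c M w y' -> y = y'.
Proof.
move=> Jy Jy'; have := resolvent_nonexpansive Jy Jy'.
rewrite subrr mulmx0 inner0l => /(sym_posdef_le0 pN).
by move/eqP; rewrite subr_eq0 => /eqP.
Qed.

Lemma resolvent_exists w : exists y, resolvent A c M w y.
Proof.
have [y Ay] := Minty_surjective maxA domA w pN.
by exists y; apply/resolventP.
Qed.

Lemma sysSP x y xi eta : sysS A p n x y xi eta <->
  [/\ A y xi, eta = c *: M *m xi + (y - x)
    & inner (N *m eta) eta <= sigma ^+ 2 *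
        (inner (N *m (c *: M *m xi)) (c *: M *m xi)
         + inner (N *m (y - x)) (y - x))].
Proof.
have NE v : inner (N *m v) v = c^-1 * wnorm (invmx M) v ^+ 2.
  rewrite wnorm_sqr; last exact: sym_posdef_inv.
  rewrite /N invmxZ ?unitfE ?gt_eqF ?sym_posdef_unit//.
  by rewrite -scalemxAl innerZl.
rewrite /sysS eps0 mulr0 addr0 !NE -mulrDr [_ * (c^-1 * _)]mulrCA.
rewrite ler_pM2l ?invr_gt0// scalemxAl addrA.
by split=> -[Ay ? ?]; split=> //; apply/(enlargement0P maxA).
Qed.

Lemma sysS_resolvent x y xi eta : sysS A p n x y xi eta ->
  resolvent A c M (x + eta) y.
Proof.
move=> /sysSP[Ay -> _]; exists xi => //.
by rewrite -scalemxAl addrCA [x + _]addrC subrK addrC.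
Qed.

Lemma sysS_xiE x y xi eta : sysS A p n x y xi eta ->
  xi = N *m eta - N *m (y - x).
Proof. by move=> /sysSP[_ -> _]; rewrite -mulmxBr addrK NcM. Qed.

Lemma sysS_inj x y y' xi xi' eta :
  sysS A p n x y xi eta -> sysS A p n x y' xi' eta -> y = y' /\ xi = xi'.
Proof.
move=> S S'; have yy' := resolvent_inj (sysS_resolvent S) (sysS_resolvent S').
by split=> //; rewrite (sysS_xiE S) (sysS_xiE S') yy'.
Qed.

Lemma sysS_of_resolvent x y eta : resolvent A c M (x + eta) y ->
  inner (N *m eta) eta <= sigma ^+ 2 *
    (inner (N *m (eta - (y - x))) (eta - (y - x))
     + inner (N *m (y - x)) (y - x)) ->
  sysS A p n x y (N *m (eta - (y - x))) eta.
Proof.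
move=> /resolventP Ay err; apply/sysSP; rewrite cMN; split=> //.
  by rewrite opprB addrCA addrA.
by rewrite subrK.
Qed.

Lemma step_den_neq0 xi : xi != 0 -> step_den p n xi != 0.
Proof.
move=> xi0; rewrite /step_den wnorm_sqr; last exact: sym_posdef_inv.
rewrite mulKmx ?sym_posdef_unit// innerC gt_eqF//.
exact: pM.2.
Qed.

(** With zero error the test holds for every [sigma_n], and [c M xi = x - y] shows that [xi]
    vanishes only when [y = x]. *)
Lemma sysS_exact x : exists y xi,
  sysS A p n x y xi 0 /\ (y != x -> xi != 0).
Proof.
have [y Jy] := resolvent_exists x.
exists y, (N *m (0 - (y - x))); split.
  apply: sysS_of_resolvent; first by rewrite addr0.
  by rewrite mulmx0 inner0l mulr_ge0 ?sqr_ge0// addr_ge0 ?sym_posdef_ge0.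
apply: contra_neq => /(congr1 (fun v => c *: M *m v)); rewrite cMN mulmx0 sub0r.
by move/eqP; rewrite oppr_eq0 subr_eq0 => /eqP.
Qed.

Lemma sysS_inexact x : ~ zeros A x -> 0 < sigma ->
  exists2 r, 0 < r & forall eta, enorm eta < r -> exists y xi,
    sysS A p n x y xi eta /\ xi != 0.
Proof.
move=> nzx s0; have [y0 Jy0] := resolvent_exists x.
pose nrm v := inner (N *m v) v.
have d0 : 0 < nrm (y0 - x).
  apply: pN.2; rewrite subr_eq0; apply: contra_not_neq nzx => y0x.
  by have /resolventP := Jy0; rewrite y0x subrr mulmx0.
have [C C0 nrmC] := quadratic_form_bounded N.
(* The part [2 / sigma^2] secures the error test; the 5 beats the factor 4 that [far] would give if
   [xi] were 0. *)
pose K := 5 + 2 / sigma ^+ 2.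
have s20 : 0 < sigma ^+ 2 by rewrite exprn_gt0.
have K0 : 0 < K by rewrite addr_gt0 ?divr_gt0.
(* [C] passes from the Euclidean norm to the [N]-norm, so that [K * nrm eta < nrm (y0 - x)]. *)
exists (Num.sqrt (nrm (y0 - x) / (C * K))).
  by rewrite sqrtr_gt0 divr_gt0 ?mulr_gt0.
move=> eta; rewrite /enorm ltr_sqrt ?divr_gt0 ?mulr_gt0//.
rewrite ltr_pdivlMr ?mulr_gt0// mulrA => etar.
have {}etar : nrm eta * K < nrm (y0 - x).
  by apply: le_lt_trans etar; rewrite ler_pM2r// [_ * C]mulrC nrmC.
have {etar} [eta5 etas] : 5 * nrm eta <= nrm (y0 - x) /\
    2 * nrm eta <= sigma ^+ 2 * (nrm (y0 - x) - 5 * nrm eta).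
  have e0 : 0 <= nrm eta by apply: sym_posdef_ge0.
  have KE : 2 = sigma ^+ 2 * (K - 5).
    by rewrite /K addrC addKr mulrC divfK ?gt_eqF.
  have K5 : 0 <= K - 5 by rewrite /K addrC addKr divr_ge0 ?ltW.
  by split; [nra | rewrite {1}KE; nra].
have [y Jy] := resolvent_exists (x + eta).
have close : nrm (y0 - y) <= nrm eta.
  have := resolvent_nonexpansive Jy Jy0; rewrite [x + eta]addrC addrK.
  by rewrite /nrm -opprB mulmxN innerNl innerNr opprK.
have far : nrm (y0 - x) <= 2 * nrm eta + 2 * nrm (y - x).
  have := sym_posdef_ge0 ((y0 - y) - (y - x)) pN; move: close.
  have -> : y0 - x = (y0 - y) + (y - x) by rewrite addrA subrK.
  rewrite /nrm.
  move: (y0 - y) (y - x) => v w; rewrite !innerE (inner_sym w v pN.1).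
  by lra.
have e0 : 0 <= nrm eta by apply: sym_posdef_ge0.
exists y, (N *m (eta - (y - x))); split.
  apply: sysS_of_resolvent => //.
  have : 0 <= nrm (eta - (y - x)) by apply: sym_posdef_ge0.
  by rewrite -/(nrm eta) -/(nrm (y - x)) -/(nrm (eta - (y - x))); nra.
(* If [xi = 0] then [eta = y - x], and [far] yields [nrm (y0 - x) <= 4 * nrm eta], against [eta5]
   and [d0]. *)
apply/eqP => /(congr1 (fun v => c *: M *m v)); rewrite cMN mulmx0.
by move/eqP; rewrite subr_eq0 => /eqP etaE; rewrite -etaE in far; lra.
Qed.

Lemma sysS_zero x : zeros A x -> sysS A p n x x 0 0.
Proof.
move=> zx; apply/sysSP.
by rewrite !(subrr, mulmx0, addr0, inner0l, mulr0); split.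
Qed.

Lemma sysS_eta0 x y xi eta : sigma = 0 -> sysS A p n x y xi eta -> eta = 0.
Proof.
by move=> s0 /sysSP[_ _]; rewrite s0 expr0n mul0r => /(sym_posdef_le0 pN).
Qed.

(** If one of [y - x] and [c M xi] is 0, then [eta] is the other, and the test bounds its squared
    norm by [sigma^2 < 1] times itself, so both vanish. *)
Lemma sysS_stop x y xi eta : 0 <= sigma < 1 -> sysS A p n x y xi eta ->
  (x = y -> zeros A x) /\ (x <> y -> xi != 0).
Proof.
move=> /andP[s0 s1] /sysSP[Ay etaE err].
have s2 : sigma ^+ 2 < 1 by rewrite expr_lt1.
have small v : inner (N *m v) v <= sigma ^+ 2 * inner (N *m v) v -> v = 0.
  by move=> le_v; apply: (sym_posdef_le0 pN); nra.
split=> [xy|/eqP xy].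
  move: Ay err; rewrite etaE -xy subrr addr0 mulmx0 inner0l addr0 => Ax.
  by move/small => xi0; rewrite /zeros /= -[0](mulmx0 _ N) -xi0 NcM.
apply: contra_neq xy => xi0; move: err.
rewrite etaE xi0 !mulmx0 inner0l !add0r => /small /eqP.
by rewrite subr_eq0 => /eqP.
Qed.

End OneStep.

(** * Runs of the algorithm and the final assembly *)

(** Choice turns solvability at every [(n, x)] into a step function, which is then iterated even
    past a stop. [Q] carries the requirement on the error, exact or inexact. *)
Lemma algorithm_run_exists {R : realType} {m : nat}
    (A : 'cV[R]_m -> set 'cV[R]_m) (p : params R m)
    (Q : nat -> 'cV[R]_m -> 'cV[R]_m -> Prop) (x0 : 'cV[R]_m) :
  (forall n x, exists y xi eta, [/\ sysS A p n x y xi eta,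
     y <> x -> step_den p n xi != 0 & Q n x eta]) ->
  exists s, algorithm_run A p x0 s /\ forall n, Q n (xseq s n) (etaseq s n).
Proof.
move=> step; pose X := 'cV[R]_m.
have /choice[f fP] (q : nat * X) : exists t : X * X * X,
    [/\ sysS A p q.1 q.2 t.1.1 t.1.2 t.2,
        t.1.1 <> q.2 -> step_den p q.1 t.1.2 != 0
      & Q q.1 q.2 t.2].
  by case: q => n x; have [y [xi [eta S]]] := step n x; exists (y, xi, eta).
pose next n x := x - (tpar p n * step_len p n x (f (n, x)).1.1 (f (n, x)).1.2)
  *: (Mpar p n *m (f (n, x)).1.2).
pose xs := fix xs n := if n is k.+1 then next k (xs k) else x0.
pose t n := f (n, xs n).
exists (Iterates xs (fun n => (t n).1.1) (fun n => (t n).1.2) (fun n => (t n).2)).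
split=> [|n]; last by case: (fP (n, xs n)).
split=> // n _; have [Sn den_n _] := fP (n, xs n).
by split=> // yx; split=> //; apply: den_n.
Qed.

Theorem theorem11p2 (R : realType) (m : nat) (m_gt0 : (0 < m)%N)
    (A : 'cV[R]_m -> set 'cV[R]_m)
    (maxA : maximally_monotone A) (zerA : zeros A !=set0)
    (sigma theta : R) (sigma_gt0 : 0 < sigma)
    (p : params R m) (adm : admissible sigma theta p)
    (eps0 : forall n : nat, epar p n = 0) :
  (* existence of sequences, exact case *)
  (forall x0 : 'cV[R]_m, exists s : iterates R m,
     algorithm_run A p x0 s /\
     (forall n : nat, generates A p x0 s n -> etaseq s n = 0)) /\
  (* existence of sequences, inexact case *)
  (forall x0 : 'cV[R]_m, exists s : iterates R m,
     algorithm_run A p x0 s /\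
     (forall n : nat, generates A p x0 s n ->
        ~ zeros A (xseq s n) -> 0 < spar p n -> etaseq s n <> 0)) /\
  (* the three possibilities at step n *)
  (forall (n : nat) (x : 'cV[R]_m),
     [/\ (* at least one of them holds *)
         [\/ zeros A x, spar p n = 0 | ~ zeros A x /\ 0 < spar p n],
         (* (i) *)
         zeros A x -> sysS A p n x x 0 0,
         (* (ii) *)
         spar p n = 0 ->
           (exists! t : 'cV[R]_m * 'cV[R]_m * 'cV[R]_m,
              sysS A p n x t.1.1 t.1.2 t.2) /\
           (forall y xi eta : 'cV[R]_m, sysS A p n x y xi eta ->
              [/\ resolvent A (cpar p n) (Mpar p n) x = [set y],
                  xi = - (invmx (cpar p n *: Mpar p n) *m (y - x))
                & eta = 0])
       & (* (iii) *)
         ~ zeros A x -> 0 < spar p n ->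
           exists r : R, 0 < r /\
             forall eta : 'cV[R]_m, enorm eta < r ->
               (exists! t : 'cV[R]_m * 'cV[R]_m,
                  sysS A p n x t.1 t.2 eta) /\
               (forall y xi : 'cV[R]_m, sysS A p n x y xi eta ->
                  resolvent A (cpar p n) (Mpar p n) (x + eta) = [set y] /\
                  xi = invmx (cpar p n *: Mpar p n) *m eta
                       - invmx (cpar p n *: Mpar p n) *m (y - x))]) /\
  (* termination and continuation when sigma_n < 1 *)
  (forall (x0 : 'cV[R]_m) (s : iterates R m) (n : nat),
     generates A p x0 s n -> sysS_at A p s n -> 0 <= spar p n < 1 ->
     (xseq s n = yseq s n -> zeros A (xseq s n)) /\
     (xseq s n <> yseq s n ->
        xiseq s n <> 0 /\ step_den p n (xiseq s n) != 0)).
Proof.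
have domA : exists x u, A x u by case: zerA => x Ax; exists x, 0.
have c0 n : 0 < cpar p n by case: (adm n).
have pM n : sym_posdef (Mpar p n) by case: (adm n).
have s0 n : 0 <= spar p n by case: (adm n) => _ _ /andP[].
have resolventE n w y : resolvent A (cpar p n) (Mpar p n) w y ->
    resolvent A (cpar p n) (Mpar p n) w = [set y].
  move=> Jy; apply/seteqP; split=> [y' Jy'|y' -> //].
  exact: resolvent_inj Jy' Jy.
split; [|split; [|split]].
- move=> x0.
  have [|s [run etas]] := algorithm_run_exists A p (fun _ _ eta => eta = 0) x0.
    move=> n x.
    have [y [xi [S cont]]] := sysS_exact maxA domA (c0 n) (pM n) (eps0 n) x.
    exists y, xi, 0; split=> // /eqP yx.
    by apply: step_den_neq0 => //; apply: cont.
  by exists s; split=> // n _.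
- move=> x0; pose Q n x (eta : 'cV[R]_m) :=
    ~ zeros A x -> 0 < spar p n -> eta <> 0.
  have [|s [run etas]] := algorithm_run_exists A p Q x0; last first.
    by exists s; split=> // n _; apply: etas.
  move=> n x; have [[nzx sn]|nexact] := pselect (~ zeros A x /\ 0 < spar p n).
    have [r r0 rP] := sysS_inexact maxA domA (c0 n) (pM n) (eps0 n) nzx sn.
    (* A unit vector, available since [0 < m]; the error [(r / 2) e] is nonzero and inside the
       ball. *)
    pose e : 'cV[R]_m := delta_mx (Ordinal m_gt0) 0.
    have ee : inner e e = 1 by rewrite inner_delta mxE !eqxx.
    have [|y [xi [S xi0]]] := rP ((r / 2) *: e).
      rewrite /enorm innerZl innerZr ee mulr1 -expr2 sqrtr_sqr gtr0_norm; lra.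
    exists y, xi, ((r / 2) *: e); split=> // [_|_ _].
      exact: step_den_neq0.
    move=> /(congr1 (fun v => inner e v)).
    by rewrite innerZr ee [inner e 0]innerC inner0l; lra.
  (* Here [Q] is vacuous, and the exact step serves. *)
  have [y [xi [S cont]]] := sysS_exact maxA domA (c0 n) (pM n) (eps0 n) x.
  exists y, xi, 0; split=> // [/eqP yx|nzx sn].
    by apply: step_den_neq0 => //; apply: cont.
  by case: nexact.
- move=> n x; split.
  + have [zx|nzx] := pselect (zeros A x); first by constructor 1.
    have := s0 n; rewrite le_eqVlt => /predU1P[<-|sn]; first by constructor 2.
    by constructor 3.
  + exact: sysS_zero.
  + move=> sn0.
    have [y [xi [S _]]] := sysS_exact maxA domA (c0 n) (pM n) (eps0 n) x.
    have eta0 y' xi' eta' : sysS A p n x y' xi' eta' -> eta' = 0.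
      exact: (sysS_eta0 maxA (c0 n) (pM n) (eps0 n) sn0).
    split.
      exists (y, xi, 0); split=> // -[[y' xi'] eta'] /= S'.
      have eta'0 := eta0 _ _ _ S'; subst eta'.
      by have [-> ->] := sysS_inj maxA (c0 n) (pM n) (eps0 n) S S'.
    move=> y' xi' eta' S'; have eta'0 := eta0 _ _ _ S'; subst eta'; split=> //.
      have := sysS_resolvent maxA (c0 n) (pM n) (eps0 n) S'.
      by rewrite addr0 => /resolventE.
    by rewrite (sysS_xiE maxA (c0 n) (pM n) (eps0 n) S') mulmx0 sub0r.
  + move=> nzx sn.
    have [r r0 rP] := sysS_inexact maxA domA (c0 n) (pM n) (eps0 n) nzx sn.
    exists r; split=> // eta /rP[y [xi [S _]]]; split.
      exists (y, xi); split=> // -[y' xi'] /= S'.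
      by have [-> ->] := sysS_inj maxA (c0 n) (pM n) (eps0 n) S S'.
    move=> y' xi' S'; split.
      exact/resolventE/(sysS_resolvent maxA (c0 n) (pM n) (eps0 n) S').
    exact: (sysS_xiE maxA (c0 n) (pM n) (eps0 n) S').
- move=> x0 s n _ Sn sn.
  have [stop cont] := sysS_stop maxA (c0 n) (pM n) (eps0 n) sn Sn.
  split=> // /cont xi0; split; first exact/eqP.
  exact: step_den_neq0.
Qed.
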